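(* For every $\ell\ge1$ there is no algorithm which, given a guarded probabilistic loop with affine updates, computes a finite basis of its moment invariant ideal $\mathbb{I}^{\le\ell}$ of order $\ell$.
   Context: A guarded probabilistic loop with affine updates over variables $x_1,\dots,x_k$ consists of an initial assignment $v\in\mathbb{Q}^k$ and finitely many loop transitions, each given by a rational probability $pr\in(0,1]$, a guard that is a Boolean combination of affine equalities and strict inequalities among the variables with rational coefficients, and an affine update map $f:\mathbb{Q}^k\to\mathbb{Q}^k$ with rational coefficients; it is required that in every configuration at least one transition is enabled (guard true) and that the probabilities of the enabled transitions sum to $1$. Starting from $v$, each loop iteration picks an enabled transition with its probability and applies its update, giving a Markov chain on $\mathbb{Q}^k$. For a monomial $M$ in $x_1,\dots,x_k$, $\mathbb{E}[M_n]$ is the expected value of $M$ on the configuration after $n$ loop iterations. For $\ell\ge1$, $\mathbb{E}^{\le\ell}=\{\mathbb{E}[x_1^{\alpha_1}\cdots x_k^{\alpha_k}]:\alpha_1+\dots+\alpha_k\le\ell\}=\{\mathbb{E}[M^{(1)}],\dots,\mathbb{E}[M^{(m)}]\}$ is treated as a finite set of formal variables, and the moment invariant ideal is $\mathbb{I}^{\le\ell}=\{p\in\overline{\mathbb{Q}}[\mathbb{E}^{\le\ell}]: p(\mathbb{E}[M^{(1)}_n],\dots,\mathbb{E}[M^{(m)}_n])=0\ \text{for all } n\in\mathbb{N}_0\}$, where $\overline{\mathbb{Q}}$ denotes the algebraic numbers. *)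

(* Defs.v *)
From HB Require Import structures.
From mathcomp Require Import all_boot all_order all_algebra all_field.
From mathcomp Require Import mpoly.
From Stdlib Require List.
Unset Printing Implicit Defensive.
Import Order.TTheory GRing.Theory Num.Theory.
Local Open Scope ring_scope.

Inductive mrec : Type :=
| RZero : mrec
| RSucc : mrec
| RProj : nat -> mrec
| RComp : mrec -> list mrec -> mrec
| RPrim : mrec -> mrec -> mrec
| RMu   : mrec -> mrec.

Inductive rec_eval : mrec -> seq nat -> nat -> Prop :=
| ev_zero v : rec_eval RZero v 0
| ev_succ x v : rec_eval RSucc (x :: v) x.+1
| ev_proj i v : (i < size v)%N -> rec_eval (RProj i) v (nth 0%N v i)
| ev_comp f gs v ys y :
    mevals gs v ys -> rec_eval f ys y -> rec_eval (RComp f gs) v y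
| ev_prim0 f g v y : rec_eval f v y -> rec_eval (RPrim f g) (0%N :: v) y
| ev_primS f g n v r y :
    rec_eval (RPrim f g) (n :: v) r -> rec_eval g (n :: r :: v) y ->
    rec_eval (RPrim f g) (n.+1 :: v) y
| ev_mu f v n :
    rec_eval f (n :: v) 0%N ->
    (forall m, (m < n)%N -> exists k, rec_eval f (m :: v) k.+1) ->
    rec_eval (RMu f) v n
with mevals : list mrec -> seq nat -> seq nat -> Prop :=
| evs_nil v : mevals nil v [::]
| evs_cons g gs v y ys :
    rec_eval g v y -> mevals gs v ys -> mevals (g :: gs) v (y :: ys).

Definition affval (a : seq rat) (c : rat) (x : seq rat) : rat :=
  \sum_(j < size a) a`_j * x`_j + c.

(* Boolean combinations of affine equalities (= 0) and strict
   inequalities (> 0; "< 0" is obtained by negating the form). *)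
Inductive guard : Type :=
| GTrue : guard
| GEq : seq rat -> rat -> guard
| GGt : seq rat -> rat -> guard
| GNot : guard -> guard
| GAnd : guard -> guard -> guard
| GOr : guard -> guard -> guard.

Fixpoint gholds (g : guard) (x : seq rat) : bool :=
  match g with
  | GTrue => true
  | GEq a c => affval a c x == 0
  | GGt a c => 0 < affval a c x
  | GNot g1 => ~~ gholds g1 x
  | GAnd g1 g2 => gholds g1 x && gholds g2 x
  | GOr g1 g2 => gholds g1 x || gholds g2 x
  end.

(* A loop transition: probability, guard, affine update x |-> A x + b,
   A given as the list of its rows. *)
Record trans := Trans {
  tprob : rat;
  tguard : guard;
  tmat : seq (seq rat);
  tvec : seq rat }.

Record loop := Loop {
  lk : nat;
  linit : seq rat;
  ltrans : seq trans }.

Definition update (k : nat) (t : trans) (x : seq rat) : seq rat :=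
  [seq \sum_(j < k) (nth [::] (tmat t) i)`_j * x`_j + (tvec t)`_i
  | i <- iota 0 k].

Fixpoint gwf (k : nat) (g : guard) : bool :=
  match g with
  | GTrue => true
  | GEq a _ | GGt a _ => size a == k
  | GNot g1 => gwf k g1
  | GAnd g1 g2 | GOr g1 g2 => gwf k g1 && gwf k g2
  end.

Definition enabled (L : loop) (x : seq rat) : seq trans :=
  [seq t <- ltrans L | gholds (tguard t) x].

Definition valid_loop (L : loop) : Prop :=
  [/\ size (linit L) = lk L,
      (forall t, List.In t (ltrans L) ->
         [/\ 0 < tprob t <= 1, gwf (lk L) (tguard t),
             size (tmat t) = lk L,
             all (fun r => size r == lk L) (tmat t) &
             size (tvec t) = lk L]) &
      (forall x : seq rat, size x = lk L ->
         ~~ nilp (enabled L x) /\ \sum_(t <- enabled L x) tprob t = 1)].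

(* Distribution after n iterations, as a finite list of (probability, state). *)
Definition step (L : loop) (d : seq (rat * seq rat)) : seq (rat * seq rat) :=
  flatten [seq [seq (ps.1 * tprob t, update (lk L) t ps.2) | t <- enabled L ps.2]
          | ps <- d].

Definition dist (L : loop) (n : nat) : seq (rat * seq rat) :=
  iter n (step L) [:: (1, linit L)].

Definition expect (L : loop) (n : nat) (al : seq nat) : rat :=
  \sum_(ps <- dist L n) ps.1 * \prod_(i < size al) (ps.2)`_i ^+ (nth 0%N al i).

Fixpoint tuples (k l : nat) : seq (seq nat) :=
  match k with
  | 0 => [:: [::]]
  | k1.+1 => flatten [seq [seq a :: s | s <- tuples k1 l] | a <- iota 0 l.+1]
  end.

(* the exponent vectors al with |al| <= l; the formal variables E^{<=l}
   are E[x^al] for al in monos k l, the i-th variable being nth [::] monos i *)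
Definition monos (k l : nat) : seq (seq nat) :=
  [seq s <- tuples k l | (sumn s <= l)%N].

Definition nvars (k l : nat) : nat := size (monos k l).

Definition Epoly (k l : nat) := {mpoly algC[nvars k l]}.

Definition Evar (k l : nat) (al : seq nat) : Epoly k l :=
  \sum_(i < nvars k l | nth [::] (monos k l) i == al) 'X_i.

Definition Evals (L : loop) (l n : nat) : 'I_(nvars (lk L) l) -> algC :=
  fun i => ratr (expect L n (nth [::] (monos (lk L) l) i)).

Definition in_moment_ideal (L : loop) (l : nat) (p : Epoly (lk L) l) : Prop :=
  forall n : nat, p.@[Evals L l n] = 0.

Definition in_ideal_gen (n : nat) (B : seq {mpoly algC[n]}) (p : {mpoly algC[n]}) :
    Prop :=
  exists cs : seq {mpoly algC[n]}, p = \sum_(i < size B) cs`_i * B`_i.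

Definition is_moment_basis (L : loop) (l : nat) (B : seq (Epoly (lk L) l)) : Prop :=
  (forall b, b \in B -> in_moment_ideal L l b) /\
  (forall p, in_moment_ideal L l p -> in_ideal_gen (nvars (lk L) l) B p).

Fixpoint guard_tree (g : guard) : GenTree.tree (seq rat * rat) :=
  match g with
  | GTrue => GenTree.Node 0 [::]
  | GEq a c => GenTree.Node 1 [:: GenTree.Leaf (a, c)]
  | GGt a c => GenTree.Node 2 [:: GenTree.Leaf (a, c)]
  | GNot g1 => GenTree.Node 3 [:: guard_tree g1]
  | GAnd g1 g2 => GenTree.Node 4 [:: guard_tree g1; guard_tree g2]
  | GOr g1 g2 => GenTree.Node 5 [:: guard_tree g1; guard_tree g2]
  end.

Definition encode_loop (L : loop) : nat :=
  pickle (lk L, linit L,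
          [seq (tprob t, guard_tree (tguard t), tmat t, tvec t) | t <- ltrans L]).

(* An algebraic number is coded by (cs, (a, b), r): a nonzero polynomial with
   rational coefficients cs and an open disc of center a + b i and radius r
   containing exactly one of its roots. *)
Definition algcode := (seq rat * (rat * rat) * rat)%type.

Definition alg_denotes (c : algcode) (z : algC) : Prop :=
  let P := Poly [seq ratr q | q <- c.1.1] : {poly algC} in
  let ctr := ratr c.1.2.1 + 'i * ratr c.1.2.2 in
  P != 0 /\ root P z /\
  forall w, root P w -> (`|w - ctr| < ratr c.2 <-> w = z).

(* A polynomial in the E-variables is coded as a list of terms
   (coefficient, [:: (al_1, e_1); ...]) meaning
   coefficient * E[x^al_1]^e_1 * ... . *)
Definition polycode := seq (algcode * seq (seq nat * nat)).

Definition poly_denotes (k l : nat) (c : polycode) (p : Epoly k l) : Prop :=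
  exists zs : seq algC,
    size zs = size c /\
    (forall i, (i < size c)%N -> alg_denotes (nth ((([::], (0, 0)), 0), [::]) c i).1 zs`_i) /\
    (forall i, (i < size c)%N ->
       all (fun ae => ae.1 \in monos k l) (nth ((([::], (0, 0)), 0), [::]) c i).2) /\
    p = \sum_(i < size c)
          zs`_i *: \prod_(ae <- (nth ((([::], (0, 0)), 0), [::]) c i).2)
                     (Evar k l ae.1) ^+ ae.2.

Definition output_denotes (k l : nat) (out : nat) (B : seq (Epoly k l)) : Prop :=
  exists cs : seq polycode,
    unpickle out = Some cs /\ size cs = size B /\
    forall i, (i < size cs)%N -> poly_denotes k l (nth [::] cs i) (nth 0 B i).

Definition computes_moment_basis (l : nat) (f : mrec) : Prop :=
  forall L : loop, valid_loop L ->
    exists out : nat, rec_eval f [:: encode_loop L] out /\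
      exists B : seq (Epoly (lk L) l),
        output_denotes (lk L) l out B /\ is_moment_basis L l B.

(* Main.v *)
Require Import Defs.
From mathcomp Require Import all_boot all_order all_algebra all_field mpoly.
From mathcomp Require Import zify.

(** A loop without random choices can run any mu-recursive function: the
program counter and the registers are its variables. Suppose [f] computes
bases. Take the loop that receives the code of its own transitions in its
initial assignment, rebuilds the code of the whole loop, applies [f] to it,
obtaining [out], sets a register [t] to [y = l * out], and then counts [t]
down to 0 and stops. During the countdown the moments run through the points
s = y, ..., 0 of a curve whose coordinates are polynomials of degree at most
[l] in the value [s] of [t]. The orbit is finite, so the ideal contains a
polynomial not vanishing identically on this curve, and therefore so does any
basis. Restricted to the curve that basis element is a nonzero univariate
polynomial with [y + 1] roots, of degree at most [l] times the sum of the
exponents in one of its terms. But the code of a basis is at least as large as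
each such sum, so y + 1 <= l * out = y. *)

Set Implicit Arguments.
Unset Strict Implicit.
Unset Printing Implicit Defensive.
Import Order.TTheory GRing.Theory Num.Theory.
Local Open Scope ring_scope.

(** * Codes bound the degrees of the polynomials they denote *)

(** [CodeSeq.code] puts [x] in front of a list with code [c] as [2 ^ x * (2 * c + 1)], and
    [x < 2 ^ x]. *)
Lemma leq_sumn_code s : (sumn s <= CodeSeq.code s)%N.
Proof.
elim: s => //= x s IHs.
have := ltn_expl x (isT : (1 < 2)%N); set e := (2 ^ x)%N => ltxe.
by nia.
Qed.

(** Decoding a sequence always succeeds and drops the entries that do not decode. An output thus
    need not be of the form [pickle cs], and the bounds below are on what [unpickle] returns. *)
Lemma unpickle_seqP (T : countType) n (s : seq T) :
  unpickle n = Some s -> s = pmap unpickle (CodeSeq.decode n).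
Proof. by case=> <-. Qed.

Lemma unpickle_seq_mem (T : countType) n (s : seq T) x :
  unpickle n = Some s -> x \in s -> exists2 m, (m <= n)%N & unpickle m = Some x.
Proof.
move=> /unpickle_seqP ->; rewrite mem_pmap => /mapP[m m_n eqx].
by exists m => //; apply/ltnW/(allP (CodeSeq.gtn_decode n)).
Qed.

Lemma unpickle_pairP (T1 T2 : countType) n (x : T1) (y : T2) :
  unpickle n = Some (x, y) ->
  exists a b, [/\ (a + b <= n)%N, unpickle a = Some x & unpickle b = Some y].
Proof.
move=> H.
(* A pair is coded as a dependent pair, that is, as a list of two codes. *)
have {H} : omap (@pair_of_tag T1 T2) (unpickle_tagged (fun=> T2) n) = Some (x, y).
  by rewrite -H.
rewrite /unpickle_tagged; have := leq_sumn_code (CodeSeq.decode n).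
rewrite CodeSeq.decodeK; case: (CodeSeq.decode n) => [|a [|b []]] //=.
rewrite addn0 => le_n; case Ea: (unpickle a) => [x'|] //=.
case Eb: (unpickle b) => [y'|] //= [<- <-].
by exists a, b.
Qed.

Lemma leq_exponents_pmap (m : seq nat) :
  (\sum_(ae <- pmap (unpickle : nat -> option (seq nat * nat)) m) ae.2
     <= sumn m)%N.
Proof.
elim: m => [|a m IHm] /=; first by rewrite big_nil.
case Ea: (unpickle a) => [[u e]|] /=; last by apply: leq_trans IHm (leq_addl _ _).
rewrite big_cons leq_add //=.
by have [b [c [le_a _ [<-]]]] := unpickle_pairP Ea; apply: leq_trans le_a; lia.
Qed.

(** Nested codes are no larger than the code around them, and at the innermost level the code of a
    list dominates even the sum of its entries. *)
Lemma leq_code_exponents out (cs : seq polycode) (c : polycode)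
    (te : algcode * seq (seq nat * nat)) :
  unpickle out = Some cs -> c \in cs -> te \in c ->
  (\sum_(ae <- te.2) ae.2 <= out)%N.
Proof.
move=> Hout /(unpickle_seq_mem Hout)[m le_m Hm] /(unpickle_seq_mem Hm)[n le_n].
case: te => z es /unpickle_pairP[a [b [le_ab _ Hb]]] /=.
rewrite (unpickle_seqP Hb); apply: leq_trans (leq_exponents_pmap _) _.
apply: leq_trans (leq_sumn_code _) _; rewrite CodeSeq.decodeK; lia.
Qed.

Lemma size_prod_deg_leq (R : comNzRingType) (I : Type) (r : seq I)
    (F : I -> {poly R}) (d : I -> nat) :
  (forall i, size (F i) <= (d i).+1)%N ->
  (size (\prod_(i <- r) F i)%R <= (\sum_(i <- r) d i).+1)%N.
Proof.
move=> Fd; elim: r => [|i r IHr]; first by rewrite !big_nil size_polyC oner_eq0.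
rewrite !big_cons; apply: leq_trans (size_polyMleq _ _) _.
by have := Fd i; lia.
Qed.

Lemma size_exp_deg_leq (R : comNzRingType) (p : {poly R}) d e :
  (size p <= d.+1)%N -> (size (p ^+ e)%R <= (d * e).+1)%N.
Proof.
move=> le_p; apply: leq_trans (size_poly_exp_leq _ _) _.
by rewrite ltnS leq_mul2r -subn1 leq_subLR le_p orbT.
Qed.

Lemma mem_tuples k l al : (al \in tuples k l) = (size al == k) && all (leq^~ l) al.
Proof.
elim: k al => [|k IHk] al; first by case: al.
have -> : tuples k.+1 l =
  flatten [seq [seq a :: s | s <- tuples k l] | a <- iota 0 l.+1] by [].
apply/flatten_mapP/idP => [[b b_l /mapP[s s_k ->]]|].
  move: s_k b_l; rewrite IHk mem_iota => /andP[/eqP sz al_l] /=.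
  by rewrite sz eqxx al_l; lia.
case: al => // a al /= /and3P[]; rewrite eqSS => sz_al le_a al_l.
have a_l : a \in iota 0 l.+1 by rewrite mem_iota; lia.
exists a => //.
by apply/mapP; exists al => //; rewrite IHk sz_al.
Qed.

Lemma mem_monos k l al : (al \in monos k l) = (size al == k) && (sumn al <= l)%N.
Proof.
rewrite mem_filter mem_tuples andbC -andbA; congr andb.
case: leqP => [le_l|]; rewrite ?andbF ?andbT //.
apply/allP => x /= x_al; apply: leq_trans le_l.
by move: x_al => /splitPr[u v]; rewrite sumn_cat /=; lia.
Qed.

Lemma horner_mmap n (h : 'I_n -> {poly algC}) (p : {mpoly algC[n]}) s :
  (mmap polyC h p).[s] = p.@[fun i => (h i).[s]].
Proof.
rewrite mevalE /mmap horner_sum; apply: eq_bigr => m _.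
rewrite hornerM hornerC; congr (_ * _).
by rewrite /mmap1 horner_prod; apply: eq_bigr => i _; rewrite horner_exp.
Qed.

Definition uvec (k i : nat) : seq nat := mkseq (fun j => (j == i) : nat) k.

Lemma uvec_monos k l i : (0 < l)%N -> (i < k)%N -> uvec k i \in monos k l.
Proof.
move=> l_gt0 lt_ik; rewrite mem_monos size_mkseq eqxx /=.
rewrite sumnE big_map (bigD1_seq i) ?mem_iota ?iota_uniq //= eqxx.
by rewrite big1 ?addn0 // => j /negPf->.
Qed.

Lemma prod_uvec k i (x : seq rat) : (i < k)%N ->
  \prod_(j < size (uvec k i)) x`_j ^+ nth 0%N (uvec k i) j = x`_i.
Proof.
move=> lt_ik; rewrite size_mkseq (bigD1 (Ordinal lt_ik)) //= nth_mkseq // eqxx.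
rewrite big1 ?mulr1 // => j ne_ji; rewrite nth_mkseq // -val_eqE in ne_ji *.
by rewrite (negPf ne_ji).
Qed.

(** * Restriction of the moment ideal to the curve of a countdown *)

Section CurveBound.

Variables (L : loop) (l : nat) (st : nat -> seq rat) (x0 : seq rat) (t y M : nat).
Hypotheses (l_gt0 : (0 < l)%N) (lt_t : (t < lk L)%N).
Hypothesis dist_st : forall n, dist L n = [:: (1, st n)].
Hypothesis st_const : forall n, (M <= n)%N -> st n = st M.
Hypothesis st_curve :
  forall j, (j <= y)%N -> exists n, st n = set_nth 0 x0 t j%:R.

Let nv := nvars (lk L) l.
Let al (i : 'I_nv) : seq nat := nth [::] (monos (lk L) l) i.

(** The moments of the point mass at [x0] with its coordinate [t] replaced by the indeterminate. *)
Let curve (i : 'I_nv) : {poly algC} :=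
  \prod_(j < size (al i))
     (if j == t :> nat then 'X else (ratr x0`_j)%:P) ^+ nth 0%N (al i) j.

Let restr : {mpoly algC[nv]} -> {poly algC} := mmap polyC curve.

Let EvalsE n i :
  Evals L l n i = ratr (\prod_(j < size (al i)) (st n)`_j ^+ nth 0%N (al i) j).
Proof. by rewrite /Evals /expect dist_st big_seq1 mul1r. Qed.

Let horner_curve j n i :
  st n = set_nth 0 x0 t j%:R -> (curve i).[j%:R] = Evals L l n i.
Proof.
move=> st_n; rewrite EvalsE horner_prod rmorph_prod.
apply: eq_bigr => m _; rewrite horner_exp rmorphXn /= st_n nth_set_nth /=.
by case: eqP => _; rewrite ?hornerX ?hornerC ?ratr_nat.
Qed.

Let size_curve i : (size (curve i) <= l.+1)%N.
Proof.
pose d (j : 'I_(size (al i))) := nth 0%N (al i) j.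
apply: leq_trans (size_prod_deg_leq (d := d) _ _) _ => [j|].
  rewrite -[d j]mul1n; apply: size_exp_deg_leq.
  by case: eqP; rewrite ?size_polyX // size_polyC; case: eqP.
rewrite ltnS -(big_mkord xpredT (nth 0%N (al i))) -(big_nth _ xpredT id) -sumnE.
have /(mem_nth [::]): (i < size (monos (lk L) l))%N by [].
by rewrite -/(al i) mem_monos => /andP[].
Qed.

Let restr_root p j : in_moment_ideal L l p -> (j <= y)%N -> root (restr p) j%:R.
Proof.
move=> p_in /st_curve[n st_n]; apply/rootP; rewrite horner_mmap -(p_in n).
by apply: meval_eq => i; rewrite (horner_curve _ st_n).
Qed.

Let size_restr_code out c p :
  (forall te, te \in c -> \sum_(ae <- te.2) ae.2 <= out)%N ->
  poly_denotes (lk L) l c p -> (size (restr p) <= (l * out).+1)%N.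
Proof.
move=> c_out [zs [_ [_ [_ ->]]]]; rewrite /restr raddf_sum /=.
apply: leq_trans (size_sum _ _ _) _; apply/bigmax_leqP => i _.
rewrite mmapZ mul_polyC; apply: leq_trans (size_scale_leq _ _) _.
have /c_out := mem_nth (([::], (0, 0), 0), [::]) (ltn_ord i).
set es := (nth _ _ _).2 => le_es; rewrite rmorph_prod /=.
apply: leq_trans (size_prod_deg_leq (d := fun ae => (l * ae.2)%N) _ _) _ => [ae|].
  rewrite rmorphXn /=; apply: size_exp_deg_leq; rewrite raddf_sum /=.
  apply: leq_trans (size_sum _ _ _) _; apply/bigmax_leqP => j _.
  by rewrite mmapX mmap1U; apply: size_curve.
by rewrite -big_distrr ltnS leq_mul2l le_es orbT.
Qed.

Lemma basis_code_bound out B :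
  output_denotes (lk L) l out B -> is_moment_basis L l B -> (y < l * out)%N.
Proof.
move=> [cs [out_cs [sz_cs cs_B]]] [B_in gen_B].
(* The moment of the variable [t] is among the formal variables because [l] is positive; it
   restricts to ['X]. *)
have t_mono := uvec_monos l_gt0 lt_t.
have lt_it : (index (uvec (lk L) t) (monos (lk L) l) < nv)%N by rewrite index_mem.
pose it := Ordinal lt_it.
have al_it : al it = uvec (lk L) t by rewrite /al nth_index.
have curve_it : curve it = 'X.
  rewrite /curve al_it size_mkseq (bigD1 (Ordinal lt_t)) //= eqxx.
  rewrite nth_mkseq // eqxx expr1 big1 ?mulr1 // => j; rewrite -val_eqE /= => ne_jt.
  by rewrite nth_mkseq // (negPf ne_jt).
(* One factor for each time up to [M]; later times repeat the value at [M], so [p] vanishes along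
   the whole orbit. *)
pose p : {mpoly algC[nv]} :=
  \prod_(n < M.+1) ('X_it - (ratr (st n)`_t)%:MP).
have p_in : in_moment_ideal L l p.
  move=> n; have lt_nM : (minn n M < M.+1)%N by rewrite ltnS geq_minr.
  rewrite rmorph_prod (bigD1 (Ordinal lt_nM)) //= mevalB mevalXU mevalC.
  rewrite EvalsE al_it prod_uvec //.
  have -> : st (minn n M) = st n.
    by case: (leqP n M) => // /ltnW /st_const ->.
  by rewrite subrr mul0r.
have restr_p : restr p != 0.
  rewrite /restr rmorph_prod; apply/prodf_neq0 => n _ /=.
  by rewrite mmapB mmapX mmap1U mmapC curve_it polyXsubC_eq0.
have [ds p_ds] := gen_B _ p_in.
have [i nz_Bi] : exists i : 'I_(size B), restr B`_i != 0.
  apply/existsP; apply: contraNT restr_p; rewrite negb_exists => /forallP B0.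
  rewrite p_ds /restr raddf_sum big1 //= => i _; rewrite rmorphM /=.
  by have := B0 i; rewrite negbK => /eqP; rewrite /restr => ->; rewrite mulr0.
have roots_Bi : all (root (restr B`_i)) [seq j%:R | j <- iota 0 y.+1].
  apply/allP => x /mapP[j]; rewrite mem_iota => lt_j ->{x}.
  by apply: restr_root; [apply: B_in; rewrite mem_nth | lia].
have := max_poly_roots nz_Bi roots_Bi.
rewrite map_inj_uniq ?iota_uniq; last first.
  by move=> a b /eqP; rewrite eqr_nat => /eqP.
rewrite size_map size_iota => /(_ isT) lt_size.
have lt_ics : (i < size cs)%N by rewrite sz_cs.
have := size_restr_code _ (cs_B i lt_ics).
move=> /(_ out); rewrite -ltnS; move=> H; apply: leq_trans lt_size (H _).
by move=> te; apply: (leq_code_exponents out_cs); rewrite mem_nth.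
Qed.

End CurveBound.

(** * Programs as loops *)

(* The state of a program is a vector of [K] rationals whose entry 0 is the
   program counter. An instruction assigns [ia * x_isrc + ic] to [x_idst]
   (nothing if [idst = 0]) and jumps to [ip0] or [ip1] according to whether
   [x_itst] vanishes. *)
Record instr := Instr {
  itst : nat; ip0 : nat; ip1 : nat;
  idst : nat; ia : rat; isrc : nat; ic : rat }.

Definition jump (r p q : nat) : instr := Instr r p q 0 0 0 0.

Section ProgramLoop.

Variables (K : nat) (P : seq instr).
Hypothesis K_gt0 : (0 < K)%N.
Hypothesis P_regs : all (fun i => (itst i < K) && (isrc i < K))%N P.

Definition instr_update (i : instr) (q : nat) (x : seq rat) : seq rat :=
  mkseq (fun m => if m == 0%N then q%:R else
                  if m == idst i then ia i * x`_(isrc i) + ic i else x`_m) K.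

Definition instr_next (i : instr) (x : seq rat) : seq rat :=
  instr_update i (if x`_(itst i) == 0 then ip0 i else ip1 i) x.

(** A fixed point once the counter is [size P]. It also serves every state whose entry 0 is no
    address, since validity of a loop concerns all rational states. *)
Definition halt : instr := jump 0 (size P) (size P).

Definition program_step (x : seq rat) : seq rat :=
  instr_next (nth halt P (index x`_0 [seq p%:R | p <- iota 0 (size P)])) x.

Definition coord_eq (m : nat) (c : rat) : guard :=
  GEq (mkseq (fun j => (j == m)%:R) K) (- c).

Definition instr_trans (g : guard) (i : instr) (q : nat) : trans :=
  Trans 1 g
    (mkseq (fun m => mkseq (fun j =>
       if m == 0%N then 0 else
       if m == idst i then ia i * (j == isrc i)%:R else (j == m)%:R) K) K)
    (mkseq (fun m => if m == 0%N then q%:R else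
                     if m == idst i then ic i else 0) K).

Fixpoint program_trans (p : nat) (Q : seq instr) : seq trans :=
  if Q is i :: Q' then
    [:: instr_trans (GAnd (coord_eq 0 p%:R) (coord_eq (itst i) 0)) i (ip0 i),
        instr_trans (GAnd (coord_eq 0 p%:R) (GNot (coord_eq (itst i) 0))) i (ip1 i)
      & program_trans p.+1 Q']
  else [::].

Fixpoint halt_guard (p n : nat) : guard :=
  if n is n'.+1 then GAnd (GNot (coord_eq 0 p%:R)) (halt_guard p.+1 n') else GTrue.

Definition program_loop (x : seq rat) : loop :=
  Loop K x (rcons (program_trans 0 P)
              (instr_trans (halt_guard 0 (size P)) halt (size P))).

Lemma sum_deltal (x : seq rat) m : (m < K)%N ->
  \sum_(j < K) (j == m :> nat)%:R * x`_j = x`_m.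
Proof.
move=> lt_m; rewrite (bigD1 (Ordinal lt_m)) //= eqxx mul1r big1 ?addr0 // => j.
by rewrite -val_eqE /= => /negPf->; rewrite mul0r.
Qed.

Lemma gholds_coord_eq m c x : (m < K)%N -> gholds (coord_eq m c) x = (x`_m == c).
Proof.
move=> lt_m; rewrite /= /affval size_mkseq.
under eq_bigr => j _ do rewrite nth_mkseq //.
by rewrite sum_deltal // subr_eq0.
Qed.

Lemma update_instr_trans g i q x : (isrc i < K)%N ->
  update K (instr_trans g i q) x = instr_update i q x.
Proof.
move=> lt_src; apply/eq_in_map => m; rewrite mem_iota /= => lt_m.
rewrite !nth_mkseq //; under eq_bigr => j _ do rewrite nth_mkseq //.
case: eqP => _; first by rewrite big1 ?add0r // => j _; rewrite mul0r.
case: eqP => _; last by rewrite sum_deltal ?addr0.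
under eq_bigr => j _ do rewrite -mulrA.
by rewrite -mulr_sumr sum_deltal.
Qed.

Lemma gholds_halt_guard p n x :
  gholds (halt_guard p n) x = (x`_0 \notin [seq q%:R | q <- iota p n]).
Proof.
elim: n p => //= n IHn p; rewrite inE negb_or -IHn; congr (_ && _).
by rewrite -(gholds_coord_eq _ _ K_gt0).
Qed.

Lemma enabled_program_trans p Q x :
  all (fun i => (itst i < K) && (isrc i < K))%N Q ->
  [seq update K t x | t <- program_trans p Q & gholds (tguard t) x] =
  if x`_0 \in [seq q%:R | q <- iota p (size Q)] then
    [:: instr_next (nth halt Q (index x`_0 [seq q%:R | q <- iota p (size Q)])) x]
  else [::].
Proof.
elim: Q p => //= i Q IHQ p /andP[/andP[lt_t lt_s] Q_regs].
have g0 := gholds_coord_eq p%:R x K_gt0; have gt := gholds_coord_eq 0 x lt_t.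
rewrite /= in g0 gt; rewrite !g0 !gt inE (eq_sym p%:R).
case: (x`_0 =P p%:R) => [x0|_] /=; last exact: IHQ.
have {IHQ} : [seq update K t x | t <- program_trans p.+1 Q
                               & gholds (tguard t) x] = [::].
  rewrite IHQ // ifN // x0; apply/mapP => -[q]; rewrite mem_iota => lt_q /eqP.
  by rewrite eqr_nat; lia.
rewrite /instr_next; case: eqP => _ /= ->; by rewrite update_instr_trans.
Qed.

Lemma program_trans_wf p Q t :
  all (fun i => (itst i < K) && (isrc i < K))%N Q ->
  List.In t (program_trans p Q) ->
  exists g i q, t = instr_trans g i q /\ gwf K g.
Proof.
elim: Q p => //= i Q IHQ p /andP[_ Q_regs] [<-|[<-|/IHQ]] //; last exact.
- by do 3!eexists; split; first reflexivity; rewrite /= !size_mkseq eqxx.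
- by do 3!eexists; split; first reflexivity; rewrite /= !size_mkseq eqxx.
Qed.

Lemma halt_guard_wf p n : gwf K (halt_guard p n).
Proof. by elim: n p => //= n IHn p; rewrite size_mkseq eqxx IHn. Qed.

Lemma program_loop_trans x t : List.In t (ltrans (program_loop x)) ->
  exists g i q, t = instr_trans g i q /\ gwf K g.
Proof.
rewrite /= -cats1 => /List.in_app_iff[/program_trans_wf|[<-|[]]]; first exact.
by do 3!eexists; split; [reflexivity | apply: halt_guard_wf].
Qed.

(** Addresses are distinct, the two tests of an instruction are complementary, and [halt_guard]
    catches all other states; hence the loop is deterministic. *)
Lemma program_loop_enabled x0 x : exists t,
  [/\ enabled (program_loop x0) x = [:: t], tprob t = 1 &
      update K t x = program_step x].
Proof.
have upd : [seq update K t x | t <- enabled (program_loop x0) x] =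
           [:: program_step x].
  rewrite /enabled /= filter_rcons /= gholds_halt_guard.
  have := enabled_program_trans 0 x P_regs.
  rewrite /program_step; case: (boolP (_ \in _)) => x0P /= upd; first by rewrite upd.
  rewrite map_rcons upd /=; rewrite update_instr_trans //=.
  by rewrite (memNindex x0P) size_map size_iota nth_default // /instr_next if_same.
case E: (enabled (program_loop x0) x) upd => [|t [|]] //= [upd].
exists t; split=> //.
have : List.In t (enabled (program_loop x0) x) by rewrite E; left.
by move=> /List.filter_In[/program_loop_trans[g [i [q [-> _]]]]].
Qed.

Lemma program_loop_valid x : size x = K -> valid_loop (program_loop x).
Proof.
move=> sz_x; split=> // [t|z _].
  move=> /program_loop_trans[g [i [q [-> g_wf]]]]; split=> //=.
  - by rewrite size_mkseq.
  - by apply/allP => _ /mapP[m _ ->]; rewrite size_mkseq.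
  - by rewrite size_mkseq.
by have [t [-> pt _]] := program_loop_enabled x z; rewrite big_seq1.
Qed.

Lemma program_loop_dist x n :
  dist (program_loop x) n = [:: (1, iter n program_step x)].
Proof.
elim: n => //= n; rewrite /dist /= => ->; rewrite /step /=.
have [t [-> pt up]] := program_loop_enabled x (iter n program_step x).
by rewrite /= pt up mulr1.
Qed.

Definition config (p : nat) (s : nat -> rat) : seq rat :=
  mkseq (fun m => if m == 0%N then p%:R else s m) K.

Lemma eq_config p s s' : (forall m, (0 < m < K)%N -> s m = s' m) ->
  config p s = config p s'.
Proof.
move=> eq_s; apply/eq_in_map => m; rewrite mem_iota /= => lt_m.
by case: eqP => // /eqP m0; apply: eq_s; rewrite lt0n m0.
Qed.

Lemma program_step_config p s : (p <= size P)%N ->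
  program_step (config p s) = instr_next (nth halt P p) (config p s).
Proof.
move=> le_p; rewrite /program_step nth_mkseq //=; congr (instr_next (nth _ _ _) _).
have inj : injective (fun q : nat => q%:R : rat).
  by move=> a b /eqP; rewrite eqr_nat => /eqP.
(* At [p = size P] the index is past the end and the default [halt] is executed. *)
rewrite index_map //; case: (ltngtP p (size P)) le_p => // [lt_p|->] _.
  have {1}<- : nth 0%N (iota 0 (size P)) p = p by rewrite nth_iota.
  by rewrite index_uniq ?size_iota ?iota_uniq.
by rewrite memNindex ?size_iota // mem_iota add0n ltnn andbF.
Qed.

End ProgramLoop.

(** * While programs and their translation into instructions *)

Inductive com : Type :=
| Op : nat -> rat -> nat -> rat -> com
| Seq : com -> com -> com
| While : nat -> com -> com.

Definition upd (s : nat -> rat) (d : nat) (v : rat) : nat -> rat :=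
  fun m => if m == d then v else s m.

Lemma updE s d v : upd s d v d = v. Proof. by rewrite /upd eqxx. Qed.

Lemma updN s d v m : m != d -> upd s d v m = s m.
Proof. by rewrite /upd => /negPf->. Qed.

Inductive exec : com -> (nat -> rat) -> (nat -> rat) -> Prop :=
| exec_op d a r c s : exec (Op d a r c) s (upd s d (a * s r + c))
| exec_seq c1 c2 s1 s2 s3 :
    exec c1 s1 s2 -> exec c2 s2 s3 -> exec (Seq c1 c2) s1 s3
| exec_while0 r c s : s r = 0 -> exec (While r c) s s
| exec_whileS r c s1 s2 s3 :
    s1 r != 0 -> exec c s1 s2 -> exec (While r c) s2 s3 ->
    exec (While r c) s1 s3.

Fixpoint com_regs (c : com) : seq nat :=
  match c with
  | Op d _ r _ => [:: d; r]
  | Seq c1 c2 => com_regs c1 ++ com_regs c2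
  | While r c1 => r :: com_regs c1
  end.

Fixpoint com_size (c : com) : nat :=
  match c with
  | Op _ _ _ _ => 1
  | Seq c1 c2 => com_size c1 + com_size c2
  | While _ c1 => (com_size c1).+2
  end.

(** Jump targets are absolute, so [p] is the address of the first instruction. A loop tests at [p],
    has its body from [p.+1] on and jumps back right after it, which accounts for the two extra
    instructions in [com_size]. *)
Fixpoint com_code (p : nat) (c : com) : seq instr :=
  match c with
  | Op d a r k => [:: Instr 0 p.+1 p.+1 d a r k]
  | Seq c1 c2 => com_code p c1 ++ com_code (p + com_size c1) c2
  | While r c1 =>
      jump r (p + (com_size c1).+2) p.+1 ::
      rcons (com_code p.+1 c1) (jump 0 p p)
  end.

Lemma size_com_code p c : size (com_code p c) = com_size c.
Proof.
elim: c p => //= [c1 IH1 c2 IH2 p|r c IH p]; first by rewrite size_cat IH1 IH2.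
by rewrite size_rcons IH.
Qed.

Lemma com_code_regs K p c : (0 < K)%N ->
  all (fun r => 0 < r < K)%N (com_regs c) ->
  all (fun i => (itst i < K) && (isrc i < K))%N (com_code p c).
Proof.
move=> K_gt0; elim: c p => /= [d a r k p|c1 IH1 c2 IH2 p|r c IH p].
- by rewrite K_gt0 => /and3P[_ /andP[_ ->]].
- by rewrite !all_cat => /andP[/IH1-> /IH2->].
- by rewrite all_rcons /= K_gt0 => /andP[/andP[_ ->] /IH->].
Qed.

Section ComSimulation.

Variables (K : nat) (P : seq instr).
Hypothesis K_gt0 : (0 < K)%N.

Definition reach (x y : seq rat) : Prop := exists n, iter n (program_step K P) x = y.

Lemma reach_trans y x z : reach x y -> reach y z -> reach x z.
Proof. by move=> [m <-] [n <-]; exists (n + m)%N; rewrite iterD. Qed.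

Lemma reach_step x : reach x (program_step K P x).
Proof. by exists 1%N. Qed.

Lemma nth_program A i Q d : P = A ++ i :: Q -> nth d P (size A) = i.
Proof. by move=> ->; rewrite nth_cat ltnn subnn. Qed.

Lemma reach_jump A r p q Q s : P = A ++ jump r p q :: Q -> (r < K)%N ->
  reach (config K (size A) s)
    (config K (if (config K (size A) s)`_r == 0 then p else q) s).
Proof.
move=> defP lt_r; have := reach_step (config K (size A) s).
rewrite program_step_config //; last by rewrite defP size_cat leq_addr.
rewrite (nth_program _ defP) /instr_next /=.
congr reach; apply/eq_in_map => m; rewrite mem_iota /= => lt_m.
by case: eqP => // m0; rewrite nth_mkseq // ; case: eqP.
Qed.

(** A single turn of a loop. It serves the induction on executions and also the countdown, where the
    configurations between turns matter and [exec] would hide them. *)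
Lemma reach_while A r c Q s s1 :
  P = A ++ com_code (size A) (While r c) ++ Q -> (0 < r < K)%N -> s r != 0 ->
  (forall A' Q', P = A' ++ com_code (size A') c ++ Q' ->
     reach (config K (size A') s) (config K (size A' + com_size c) s1)) ->
  reach (config K (size A) s) (config K (size A) s1).
Proof.
move=> defP /andP[r_gt0 lt_r] nz body.
have := reach_jump s defP lt_r.
rewrite nth_mkseq // (gtn_eqF r_gt0) (negPf nz); move/reach_trans; apply.
have /body : P = rcons A (jump r (size A + (com_size c).+2) (size A).+1) ++
    com_code (size (rcons A (jump r (size A + (com_size c).+2) (size A).+1))) c ++
    jump 0 (size A) (size A) :: Q.
  by rewrite size_rcons defP /= cat_rcons -cats1 -catA.
rewrite size_rcons => /reach_trans; apply.
have /(reach_jump s1)/(_ K_gt0) :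
  P = (A ++ jump r (size A + (com_size c).+2) (size A).+1 ::
         com_code (size A).+1 c) ++
    jump 0 (size A) (size A) :: Q.
  by rewrite defP /= -cats1 -!catA.
by rewrite size_cat /= size_com_code if_same addSnnS.
Qed.

Lemma reach_exec c s s' A Q :
  exec c s s' -> all (fun r => 0 < r < K)%N (com_regs c) ->
  P = A ++ com_code (size A) c ++ Q ->
  reach (config K (size A) s) (config K (size A + com_size c) s').
Proof.
move=> ex; elim: ex A Q => {c s s'}
  [d a r c s|c1 c2 s1 s2 s3 _ IH1 _ IH2|r c s sr0|r c s1 s2 s3 nz _ IH1 _ IH2] A Q.
- move=> /= /and3P[d_K /andP[r_gt0 lt_r] _] defP.
  have := reach_step (config K (size A) s).
  rewrite program_step_config //; last by rewrite defP size_cat leq_addr.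
  rewrite (nth_program _ defP) /instr_next if_same /= addn1.
  congr reach; apply/eq_in_map => m; rewrite mem_iota /= => lt_m.
  case: eqP => // m0; rewrite /upd nth_mkseq // (gtn_eqF r_gt0).
  by case: eqP => // md; rewrite nth_mkseq //; case: eqP.
- rewrite /= all_cat => /andP[regs1 regs2] defP.
  apply: reach_trans (IH1 A (com_code (size A + com_size c1) c2 ++ Q) regs1 _) _.
    by rewrite defP -catA.
  have := IH2 (A ++ com_code (size A) c1) Q regs2.
  by rewrite size_cat size_com_code addnA defP -!catA; apply.
- move=> /= /andP[/andP[r_gt0 lt_r] _] defP; have := reach_jump s defP lt_r.
  by rewrite nth_mkseq // (gtn_eqF r_gt0) sr0 eqxx.
- move=> regs defP; have /= /andP[r_K regs_c] := regs.
  apply: reach_trans (IH2 A Q regs defP).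
  by apply: (reach_while defP r_K nz) => A' Q'; apply: IH1.
Qed.

End ComSimulation.

(** * Compilation of mu-recursive functions *)

Lemma mrec_nested_ind (Q : mrec -> Prop) :
  Q RZero -> Q RSucc -> (forall i, Q (RProj i)) ->
  (forall f gs, Q f -> List.Forall Q gs -> Q (RComp f gs)) ->
  (forall f g, Q f -> Q g -> Q (RPrim f g)) ->
  (forall f, Q f -> Q (RMu f)) -> forall f, Q f.
Proof.
move=> Q0 QS Qp Qc Qr Qm; fix IH 1 => -[||i|f gs|f g|f]; last first.
- exact/Qm.
- exact/Qr.
- by apply: Qc => //; elim: gs => [|g gs IHgs]; constructor.
- exact: Qp.
- exact: QS.
- exact: Q0.
Qed.

(** The results go to the registers [j], [j.+1], and so on, while [j + size gs] is the same first
    scratch register at every stage. The language has no empty command: the list ends by clearing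
    [o], which is free to be overwritten. *)
Fixpoint compile_list (comp : mrec -> nat -> nat -> com) (gs : seq mrec)
    (o j : nat) : com :=
  if gs is g :: gs' then
    Seq (comp g j (j + size gs)%N) (compile_list comp gs' o j.+1)
  else Op o 0 o 0.

(* [compile f xs o b] reads its arguments in the registers [xs], writes the
   value of [f] in register [o] and uses the registers from [b] on as scratch;
   [o] also serves as a default where [f] is undefined for lack of arguments. *)
Fixpoint compile (f : mrec) (xs : seq nat) (o b : nat) : com :=
  match f with
  | RZero => Op o 0 o 0
  | RSucc => Op o 1 (head o xs) 1
  | RProj i => Op o 1 (nth o xs i) 0
  | RComp f gs =>
      Seq (compile_list (fun g => compile g xs) gs o b)
          (compile f (iota b (size gs)) o (b + size gs))
  | RPrim f g =>
      let: (i, r, m, tmp) := (b, b.+1, b.+2, b.+3) in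
      Seq (Op m 1 (head o xs) 0)
     (Seq (Op i 0 i 0)
     (Seq (compile f (behead xs) r b.+4)
     (Seq (While m
            (Seq (compile g [:: i, r & behead xs] tmp b.+4)
            (Seq (Op r 1 tmp 0)
            (Seq (Op i 1 i 1)
                 (Op m 1 m (-1))))))
          (Op o 1 r 0))))
  | RMu f =>
      Seq (Op b 0 b 0)
     (Seq (compile f (b :: xs) o b.+1)
     (Seq (While o (Seq (Op b 1 b 1) (compile f (b :: xs) o b.+1)))
          (Op o 1 b 0)))
  end.

Definition natrs (v : seq nat) : seq rat := [seq n%:R | n <- v].

Definition agree (b o : nat) (s s' : nat -> rat) : Prop :=
  forall r, (r < b)%N -> r != o -> s' r = s r.

Lemma agree_map b o s s' xs : agree b o s s' -> o \notin xs ->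
  all (gtn b) xs -> map s' xs = map s xs.
Proof.
move=> agr o_xs xs_b; apply/eq_in_map => r r_xs; apply: agr.
  exact: (allP xs_b).
by apply: contraNneq o_xs => <-.
Qed.

Definition computes (c : com) (o b : nat) (s : nat -> rat) (y : nat) : Prop :=
  exists s', [/\ exec c s s', s' o = y%:R & agree b o s s'].

(** Nothing is assumed about the initial contents of [o] and of the scratch registers, so compiled
    code can be run repeatedly inside a loop. *)
Definition compile_correct (f : mrec) : Prop :=
  forall xs o b s v y, o \notin xs -> (o < b)%N -> all (gtn b) xs ->
  map s xs = natrs v -> rec_eval f v y -> computes (compile f xs o b) o b s y.

Lemma computes_op d a r c b s y :
  a * s r + c = y%:R -> computes (Op d a r c) d b s y.
Proof.
move=> eq_y; eexists; split; first exact: exec_op.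
  by rewrite updE.
by move=> m _; apply: updN.
Qed.

Lemma compile_list_correct gs xs o j s v ys :
  List.Forall compile_correct gs ->
  o \notin xs -> (o < j)%N -> all (gtn j) xs -> map s xs = natrs v ->
  mevals gs v ys ->
  exists s', [/\ exec (compile_list (fun g => compile g xs) gs o j) s s',
    map s' (iota j (size gs)) = natrs ys & agree j o s s'].
Proof.
move=> gs_ok o_xs; elim: gs_ok j s ys => {gs} [|g gs g_ok _ IHgs] j s ys;
  move=> o_j xs_j s_xs Hys.
  inversion Hys; subst; eexists; split; [exact: exec_op|by []|].
  by move=> r _; apply: updN.
inversion Hys as [|g' gs' v' y ys' Hg Hgs]; subst.
have j_xs : j \notin xs by apply/negP => /(allP xs_j) /=; rewrite ltnn.
have xs_B k : (j <= k)%N -> all (gtn k) xs.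
  by move=> le_jk; apply: sub_all xs_j => r /=; lia.
have [||s1 [ex1 s1j agr1]] := g_ok xs j (j + size (g :: gs))%N s v y j_xs _ _ s_xs Hg.
- by rewrite /= ; lia.
- by apply: xs_B; rewrite leq_addr.
have s1_xs : map s1 xs = natrs v.
  rewrite -s_xs; apply: agree_map (j_xs) (xs_B _ (leqnn j)) => r lt_r ne_r.
  by apply: agr1 => //=; lia.
have [||s2 [ex2 s2_ys agr2]] := IHgs j.+1 s1 ys' _ _ s1_xs Hgs.
- by lia.
- exact: xs_B.
exists s2; split; first exact: exec_seq ex1 ex2.
- rewrite /= s2_ys agr2 ?s1j //; lia.
- by move=> r lt_r ne_r; rewrite agr2 ?agr1 //=; lia.
Qed.

(** Evaluation unfolds from [n] downwards while the compiled loop runs upwards; the sequence [R] of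
    intermediate values links the two. *)
Lemma prim_values f g n v y : rec_eval (RPrim f g) (n :: v) y ->
  exists R : nat -> nat, [/\ rec_eval f v (R 0%N),
    forall k, (k < n)%N -> rec_eval g [:: k, R k & v] (R k.+1) & R n = y].
Proof.
elim: n y => [|n IHn] y H.
  by inversion H; subst; exists (fun=> y).
inversion H as [| | | | |f' g' n' v' r y' Hr Hg|]; subst.
have [R [R0 RS Rn]] := IHn _ Hr; exists (fun k => if (k <= n)%N then R k else y).
split=> /= [//|k|]; last by rewrite ltnn.
rewrite ltnS leq_eqVlt => /predU1P[->|lt_k]; last by rewrite lt_k orbT; apply: RS.
by rewrite eqxx ltnn Rn.
Qed.

Lemma compile_prim_correct f g :
  compile_correct f -> compile_correct g -> compile_correct (RPrim f g).
Proof.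
move=> f_ok g_ok xs o b s w y o_xs o_b xs_b s_xs H.
have [n [v Dw]] : exists n v, w = n :: v by inversion H; subst; eauto.
subst w; have [R [R0 RS <-]] := prim_values H.
case: xs o_xs xs_b s_xs => // x0 xs o_xs /= /andP[x0_b xs_b] [s_x0 s_xs].
have xs_k k : (b <= k)%N -> all (gtn k) xs.
  by move=> le_bk; apply: sub_all xs_b => q /=; lia.
have k_xs k : (b <= k)%N -> k \notin xs.
  by move=> le_bk; apply/negP => /(allP xs_b) /=; lia.
have xs_eq s1 : (forall q, (q < b)%N -> s1 q = s q) -> map s1 xs = natrs v.
  by move=> eq_s; rewrite -s_xs; apply/eq_in_map => q /(allP xs_b) /eq_s.
(* Invariant after [k] rounds with [d] left: registers [b], [b.+1] and [b.+2] hold [k], [R k] and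
   [d], and everything below [b] is as at the start. *)
have loop_ok d k s1 : (k + d)%N = n -> s1 b = k%:R -> s1 b.+1 = (R k)%:R ->
    s1 b.+2 = d%:R -> (forall q, (q < b)%N -> s1 q = s q) ->
  exists s2, [/\ exec (While b.+2
      (Seq (compile g [:: b, b.+1 & xs] b.+3 b.+4)
        (Seq (Op b.+1 1 b.+3 0) (Seq (Op b 1 b 1) (Op b.+2 1 b.+2 (-1)))))) s1 s2,
    s2 b.+1 = (R n)%:R & forall q, (q < b)%N -> s2 q = s q].
  elim: d k s1 => [|d IHd] k s1 Dn s1i s1r s1m s1s.
    exists s1; split=> //; first exact: exec_while0.
    by rewrite s1r -Dn addn0.
  have [|||||s2 [ex2 s2_tmp agr2]] :=
      g_ok [:: b, b.+1 & xs] b.+3 b.+4 s1 [:: k, R k & v] (R k.+1).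
  + by rewrite !inE !negb_or k_xs //; lia.
  + by [].
  + by rewrite /= xs_k //; lia.
  + by rewrite /= s1i s1r xs_eq.
  + by apply: RS; lia.
  have agr q : (q < b.+3)%N -> s2 q = s1 q by move=> lt_q; apply: agr2; lia.
  pose s3 := upd s2 b.+1 (1 * s2 b.+3 + 0).
  pose s4 := upd s3 b (1 * s3 b + 1).
  pose s5 := upd s4 b.+2 (1 * s4 b.+2 + -1).
  have [|||||s6 [ex6 s6r s6s]] := IHd k.+1 s5.
  + by lia.
  + by rewrite /s5 updN /s4 ?updE /s3 ?updN ?agr ?s1i ?mul1r ?natr1 //; lia.
  + by rewrite /s5 updN /s4 ?updN /s3 ?updE ?mul1r ?addr0 //; lia.
  + rewrite /s5 updE /s4 updN /s3 ?updN ?agr ?s1m //; try lia.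
    by rewrite mul1r -natr1 addrK.
  + by move=> q lt_q; rewrite /s5 /s4 /s3 !updN ?agr ?s1s //; lia.
  exists s6; split=> //; apply: exec_whileS ex6; first by rewrite s1m pnatr_eq0.
  apply: exec_seq ex2 _; apply: exec_seq (exec_op _ _ _ _ _) _.
  exact: exec_seq (exec_op _ _ _ _ _) (exec_op _ _ _ _ _).
pose s1 := upd s b.+2 (1 * s x0 + 0).
pose s2 := upd s1 b (0 * s1 b + 0).
have s2s q : (q < b)%N -> s2 q = s q.
  by move=> lt_q; rewrite /s2 /s1 !updN //; lia.
have [|||s3 [ex3 s3r agr3]] := f_ok xs b.+1 b.+4 s2 v (R 0%N) _ _ _ (xs_eq _ s2s) R0.
- by apply: k_xs; lia.
- by lia.
- by apply: xs_k; lia.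
have [|||||s4 [ex4 s4r s4s]] := loop_ok n 0%N s3.
- by [].
- by rewrite agr3 /s2 ?updE ?mul0r ?addr0 //; lia.
- exact: s3r.
- rewrite agr3; try lia.
  by rewrite /s2 /s1 updN ?updE ?mul1r ?addr0 ?s_x0 //; lia.
- by move=> q lt_q; rewrite agr3 ?s2s //; lia.
eexists; split.
- apply: exec_seq (exec_op _ _ _ _ _) _; apply: exec_seq (exec_op _ _ _ _ _) _.
  by apply: exec_seq ex3 _; apply: exec_seq ex4 _; apply: exec_op.
- by rewrite updE mul1r addr0.
- by move=> q lt_q ne_q; rewrite updN ?s4s.
Qed.

Lemma compile_mu_correct f : compile_correct f -> compile_correct (RMu f).
Proof.
move=> f_ok xs o b s v y o_xs o_b xs_b s_xs H.
inversion H as [| | | | | |f' v' n Hn Hlt]; subst.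
have f_run k w s1 : s1 b = k%:R -> agree b o s s1 -> rec_eval f (k :: v) w ->
    computes (compile f (b :: xs) o b.+1) o b.+1 s1 w.
  move=> s1b s1s; apply: f_ok; rewrite ?inE ?negb_or ?o_xs ?andbT /=; try lia.
    by rewrite leqnn; apply: sub_all xs_b => q /=; lia.
  by rewrite s1b (agree_map s1s) // s_xs.
(* Invariant: [b] holds the candidate [k], [o] holds the value [w] of [f] there, and [d] is the
   distance to the minimum [y]. The tested register [o] is thus 0 exactly when [d] is. *)
have loop_ok d k s1 w : (k + d)%N = y -> s1 b = k%:R -> s1 o = w%:R ->
    rec_eval f (k :: v) w -> (w == 0%N) = (d == 0%N) -> agree b o s s1 ->
  exists s2, [/\ exec (While o (Seq (Op b 1 b 1) (compile f (b :: xs) o b.+1))) s1 s2,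
    s2 b = y%:R & agree b o s s2].
  elim: d k s1 w => [|d IHd] k s1 w Dy s1b s1o Hw w0 s1s.
    exists s1; split=> //; last by rewrite s1b -Dy addn0.
    by apply: exec_while0; rewrite s1o (eqP w0).
  have [w' [Hw' w'0]] : exists w',
      rec_eval f (k.+1 :: v) w' /\ (w' == 0%N) = (d == 0%N).
    (* The next value is 0 if the next candidate is [y]; otherwise [Hlt] supplies a positive one. *)
    have [d0|d_gt0] := posnP d; first by exists 0%N; rewrite (_ : k.+1 = y) //; lia.
    by have [|u Hu] := Hlt k.+1; [lia | exists u.+1].
  pose s2 := upd s1 b (1 * s1 b + 1).
  have s2s : agree b o s s2.
    by move=> q lt_q ne_q; rewrite /s2 updN ?s1s //; lia.
  have s2b : s2 b = k.+1%:R by rewrite /s2 updE s1b mul1r natr1.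
  have [s3 [ex3 s3o agr3]] := f_run _ _ _ s2b s2s Hw'.
  have [|||s4 [ex4 s4b s4s]] := IHd k.+1 s3 w' _ _ s3o Hw' w'0.
  - by lia.
  - by rewrite agr3 ?s2b //; lia.
  - by move=> q lt_q ne_q; rewrite agr3 ?s2s //; lia.
  exists s4; split=> //; apply: exec_whileS ex4.
    by rewrite s1o pnatr_eq0 w0.
  exact: exec_seq (exec_op _ _ _ _ _) ex3.
have [w0 [Hw0 w00]] : exists w, rec_eval f (0%N :: v) w /\ (w == 0%N) = (y == 0%N).
  have [y0|y_gt0] := posnP y; first by exists 0%N; split=> //; rewrite -{1}y0.
  by have [u Hu] := Hlt _ y_gt0; exists u.+1.
pose s1 := upd s b (0 * s b + 0).
have s1s : agree b o s s1 by move=> q lt_q ne_q; rewrite /s1 updN //; lia.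
have s1b : s1 b = 0%:R by rewrite /s1 updE mul0r addr0.
have [s2 [ex2 s2o agr2]] := f_run _ _ _ s1b s1s Hw0.
have [|||s3 [ex3 s3b s3s]] := loop_ok y 0%N s2 w0 _ _ s2o Hw0 w00.
- by [].
- by rewrite agr2 ?s1b //; lia.
- by move=> q lt_q ne_q; rewrite agr2 ?s1s //; lia.
eexists; split.
- apply: exec_seq (exec_op _ _ _ _ _) _; apply: exec_seq ex2 _.
  by apply: exec_seq ex3 _; apply: exec_op.
- by rewrite updE mul1r addr0.
- by move=> q lt_q ne_q; rewrite updN ?s3s.
Qed.

Lemma compileP f : compile_correct f.
Proof.
elim/mrec_nested_ind: f => [||i|f gs f_ok gs_ok|f g f_ok g_ok|f f_ok];
  try by [apply: compile_prim_correct | apply: compile_mu_correct].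
all: move=> xs o b s v y o_xs o_b xs_b s_xs H.
all: inversion H as [| | |f' gs' v' ys y' Hys Hy| | |]; subst => /=.
- by apply: computes_op; rewrite mul0r addr0.
- apply: computes_op; case: xs s_xs {o_xs xs_b} => //= a xs [-> _].
  by rewrite mul1r natr1.
- apply: computes_op; rewrite mul1r addr0.
  have sz : size xs = size v by rewrite -(size_map s) s_xs size_map.
  by rewrite -(nth_map _ 0) ?sz // s_xs (nth_map 0%N).
- have [s1 [ex1 s1_ys agr1]] := compile_list_correct gs_ok o_xs o_b xs_b s_xs Hys.
  have [|||s2 [ex2 s2_y agr2]] := f_ok _ o (b + size gs)%N _ _ _ _ _ _ s1_ys Hy.
  + by rewrite mem_iota; lia.
  + by lia.
  + by apply/allP => r; rewrite mem_iota /=; lia.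
  exists s2; split=> //; first exact: exec_seq ex1 ex2.
  by move=> r lt_r ne_r; rewrite agr2 ?agr1 //; lia.
Qed.

Lemma compile_list_regs (comp : mrec -> nat -> nat -> com) gs o j :
  List.Forall (fun g => forall o b, (0 < o)%N -> (0 < b)%N ->
    all (leq 1) (com_regs (comp g o b))) gs ->
  (0 < o)%N -> (0 < j)%N -> all (leq 1) (com_regs (compile_list comp gs o j)).
Proof.
move=> gs_ok o_gt0; elim: gs_ok j => {gs} [|g gs g_ok _ IHgs] j j_gt0 /=.
  by rewrite o_gt0.
by rewrite all_cat g_ok ?IHgs //; lia.
Qed.

(** Register 0 has to be avoided because entry 0 of a state is the program counter. *)
Lemma compile_regs f xs o b : all (leq 1) xs -> (0 < o)%N -> (0 < b)%N ->
  all (leq 1) (com_regs (compile f xs o b)).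
Proof.
elim/mrec_nested_ind: f xs o b => [||i|f gs f_ok gs_ok|f g f_ok g_ok|f f_ok]
  xs o b xs_gt0 o_gt0 b_gt0 /=.
- by rewrite o_gt0.
- by rewrite o_gt0; case: xs xs_gt0 => [|x xs] /=; rewrite ?o_gt0 // => /andP[->].
- rewrite o_gt0; case: (ltnP i (size xs)) => [lt_i|/(nth_default o)->].
    by rewrite (allP xs_gt0) // mem_nth.
  by rewrite o_gt0.
- rewrite all_cat compile_list_regs //=; last first.
    by elim: gs_ok => [|g gs' g_ok _ IH]; constructor => // o' b'; apply: g_ok.
  by apply: f_ok; [apply/allP => r; rewrite mem_iota /=; lia|lia..].
- have tl_gt0 : all (leq 1) (behead xs) by case: (xs) xs_gt0 => //= x t /andP[].
  have hd_gt0 : (0 < head o xs)%N by case: (xs) xs_gt0 => //= x t /andP[].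
  by rewrite /= !all_cat /= f_ok ?g_ok //= ?all_cat ?g_ok //= ?b_gt0 ?hd_gt0 ?o_gt0.
- have f_regs : all (leq 1) (com_regs (compile f (b :: xs) o b.+1)).
    by apply: f_ok; rewrite //= b_gt0.
  by rewrite !all_cat /= all_cat /= f_regs b_gt0 o_gt0.
Qed.

(** * Self-application *)

Definition recursive (n : nat) (F : seq nat -> nat) : Prop :=
  exists f, forall v, size v = n -> rec_eval f v (F v).

Lemma recursive_ext n F G : (forall v, size v = n -> F v = G v) ->
  recursive n F -> recursive n G.
Proof. by move=> eqFG [f fF]; exists f => v sz_v; rewrite -eqFG //; apply: fF. Qed.

Lemma recursive_proj n i : (i < n)%N -> recursive n (fun v => nth 0%N v i).
Proof. by move=> lt_i; exists (RProj i) => v sz_v; constructor; rewrite sz_v. Qed.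

Lemma recursive_comp1 n F G : recursive 1 (fun v => F (nth 0%N v 0)) ->
  recursive n G -> recursive n (fun v => F (G v)).
Proof.
move=> [f fF] [g gG]; exists (RComp f [:: g]) => v sz_v.
apply: (ev_comp _ _ _ [:: G v]); first by constructor; [apply: gG | constructor].
exact: (fF [:: G v]).
Qed.

Lemma recursive_comp2 n F G H :
  recursive 2 (fun v => F (nth 0%N v 0) (nth 0%N v 1)) ->
  recursive n G -> recursive n H -> recursive n (fun v => F (G v) (H v)).
Proof.
move=> [f fF] [g gG] [h hH]; exists (RComp f [:: g; h]) => v sz_v.
apply: (ev_comp _ _ _ [:: G v; H v]); last exact: (fF [:: G v; H v]).
by constructor; [apply: gG | constructor; [apply: hH | constructor]].
Qed.

Lemma recursive_succ : recursive 1 (fun v => (nth 0%N v 0).+1).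
Proof. by exists RSucc => -[|x []] // _; constructor. Qed.

Lemma recursive_const n c : recursive n (fun=> c).
Proof.
elim: c => [|c IHc]; first by exists RZero => v _; constructor.
exact: recursive_comp1 recursive_succ IHc.
Qed.

Lemma recursive_addc n c F : recursive n F -> recursive n (fun v => c + F v)%N.
Proof.
move=> recF; elim: c => [|c IHc]; first exact: recursive_ext recF.
exact: recursive_comp1 recursive_succ IHc.
Qed.

Lemma recursive_mulc c : recursive 1 (fun v => c * nth 0%N v 0)%N.
Proof.
have [g gP] := recursive_addc c (recursive_proj (isT : 1 < 2)%N).
exists (RPrim RZero g) => -[|x []] // _ /=.
elim: x => [|x IHx]; first by rewrite muln0; do 2!constructor.
by rewrite mulnS; apply: (ev_primS _ _ _ _ _ _ IHx (gP [:: x; (c * x)%N] _)).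
Qed.

(** This is the step by which [CodeSeq.code] adds a head to a list, so codes of lists and tuples
    become recursive. Primitive recursion doubles [(G v).*2.+1] as often as [F v] says. *)
Lemma recursive_code_cons n F G : recursive n F -> recursive n G ->
  recursive n (fun v => 2 ^ F v * (G v).*2.+1)%N.
Proof.
apply: (recursive_comp2 (F := fun x y => 2 ^ x * y.*2.+1)%N).
have [f fP] : recursive 1 (fun v => (nth 0%N v 0).*2.+1).
  apply: recursive_comp1 recursive_succ _.
  by apply: recursive_ext (recursive_mulc 2) => v _; rewrite mul2n.
have [g gP] : recursive 3 (fun v => (2 * nth 0%N v 1)%N).
  exact: recursive_comp1 (recursive_mulc 2) (recursive_proj _).
exists (RPrim f g) => -[|x [|y []]] // _ /=.
elim: x => [|x IHx]; first by rewrite mul1n; constructor; apply: (fP [:: y]).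
by rewrite expnS -mulnA; apply: (ev_primS _ _ _ _ _ _ IHx (gP [:: x; _; y] _)).
Qed.

(** An explicit formula makes this code a recursive function of [n]: a rational is coded by its
    numerator and denominator, and only the former varies. *)
Lemma pickle_natr (n : nat) :
  pickle (n%:R : rat) =
  CodeSeq.code [:: CodeSeq.code [:: CodeSeq.code [:: n]; 0%N]; pickle (1 : int)].
Proof.
suff val_n : valq n%:R = (n : int, 1 : int).
  by transitivity (pickle (valq n%:R)); rewrite // val_n.
rewrite pmulrn [LHS]surjective_pairing; congr pair.
  exact: numq_int n.
exact: denq_int n.
Qed.

Lemma recursive_pickle_natr n F : recursive n F ->
  recursive n (fun v => pickle ((F v)%:R : rat)).
Proof.
move=> recF; apply: (recursive_ext (fun v _ => esym (pickle_natr (F v)))).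
do !apply: recursive_code_cons; first [exact: recF | exact: recursive_const].
Qed.

(* [tau] stands for the code of the transitions, [K] for the number of variables
   and [z] for the code of the scratch registers: from these three numbers the
   program recovers the code of its loop without knowing its own text. *)
Definition self_init (tau K z : nat) : seq rat :=
  [:: 0; tau%:R; K%:R; z%:R] ++ nseq (K - 4) 0.

Definition zeros_code (K : nat) : nat := pickle (nseq (K - 4) (0 : rat)).

(** The function [e] does not depend on [K] and [T], which are fixed only after a program containing
    [e] is compiled. The code of [T] enters twice, as an entry of the initial vector and as the last
    component. *)
Lemma recursive_self_code : exists e, forall K T,
  rec_eval e [:: pickle T; K; zeros_code K]
    (pickle (K, self_init (pickle T) K (zeros_code K), T :
       seq (rat * GenTree.tree (seq rat * rat) * seq (seq rat) * seq rat))).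
Proof.
(* The code spelled out, with [h] coding an entry and [a] the code of the entry 0. The third
   argument occurs both as an entry and as the code of the tail of zeros. *)
pose F (h : nat -> nat) (a : nat) (v : seq nat) :=
  CodeSeq.code [:: CodeSeq.code [:: nth 0 v 1;
    2 ^ a * (2 ^ h (nth 0 v 0) * (2 ^ h (nth 0 v 1) *
      (2 ^ h (nth 0 v 2) * (nth 0 v 2).*2.+1).*2.+1).*2.+1).*2.+1];
    nth 0 v 0]%N.
have recF h a : recursive 1 (fun v => h (nth 0%N v 0)) -> recursive 3 (F h a).
  move=> rech; have proj i : (i < 3)%N -> recursive 3 (fun v => nth 0%N v i).
    exact: recursive_proj.
  have projh i lt_i := recursive_comp1 rech (proj i lt_i).
  by do !apply: recursive_code_cons;
    first [exact: recursive_const | exact: proj | exact: projh].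
have [e eP] := recF (fun n => pickle (n%:R : rat)) (pickle (0 : rat))
  (recursive_pickle_natr (recursive_proj (isT : (0 < 1)%N))).
by exists e => K T; apply: (eP [:: pickle T; K; zeros_code K]).
Qed.

(** * The countdown and its halting *)

Definition countdown (t : nat) : com := While t (Op t 1 t (-1)).

Section Countdown.

Variables (K t : nat) (c : com) (s0 s1 : nat -> rat) (y : nat).
Hypotheses (t_K : (0 < t < K)%N) (c_K : all (fun r => 0 < r < K)%N (com_regs c)).
Hypotheses (c_exec : exec c s0 s1) (s1_t : s1 t = y%:R).

Let P := com_code 0 (Seq c (countdown t)).

(** At the head of the loop, address [com_size c], the configurations differ only in register [t]:
    they are the points of the curve. *)
Lemma countdown_reach j : (j <= y)%N ->
  reach K P (config K 0 s0) (config K (com_size c) (upd s1 t j%:R)).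
Proof.
have K_gt0 : (0 < K)%N by lia.
have defP : P = com_code 0 c ++ com_code (size (com_code 0 c)) (countdown t) ++ [::].
  by rewrite cats0 size_com_code.
move=> le_j; rewrite -(subKn le_j); elim: (y - j)%N (leq_subr j y) => [|d IHd] le_d.
  have := reach_exec K_gt0 (A := [::]) c_exec c_K defP; rewrite /= subn0 add0n.
  congr reach; apply: eq_config => m _; rewrite /upd; case: eqP => // ->.
  by rewrite s1_t.
apply: reach_trans (IHd (ltnW le_d)) _.
rewrite -(size_com_code 0 c).
apply: (reach_while K_gt0 defP t_K); first by rewrite updE pnatr_eq0; lia.
move=> A Q defA.
have := reach_exec K_gt0 (exec_op t 1 t (-1) (upd s1 t (y - d)%:R)) _ defA.
rewrite /= t_K => /(_ isT); congr reach; apply: eq_config => m _.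
rewrite updE /upd; case: eqP => // _.
by rewrite mul1r (_ : (y - d = (y - d.+1).+1)%N) -?natr1 ?addrK //; lia.
Qed.

(** Once [t] is 0 the loop exits to address [size P], where [halt] fixes the configuration. *)
Lemma countdown_const : exists M, forall n, (M <= n)%N ->
  iter n (program_step K P) (config K 0 s0) =
  iter M (program_step K P) (config K 0 s0).
Proof.
have K_gt0 : (0 < K)%N by lia.
have [M reach0] := countdown_reach (leq0n y).
have defP : P = com_code 0 c ++ com_code (size (com_code 0 c)) (countdown t) ++ [::].
  by rewrite cats0 size_com_code.
have := reach_exec K_gt0 (@exec_while0 t (Op t 1 t (-1)) (upd s1 t 0) _) _ defP.
rewrite updE /= t_K => /(_ erefl isT); rewrite size_com_code => -[M1 reach1].
exists (M1 + M)%N => n le_n; rewrite -(subnK le_n) iterD.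
set x := iter (M1 + M) _ _.
have Dx : x = config K (size P) (upd s1 t 0).
  by rewrite /x iterD reach0 reach1 /P size_com_code.
elim: (n - (M1 + M))%N => //= k ->; rewrite Dx program_step_config //.
rewrite nth_default // /instr_next if_same.
apply/eq_in_map => m; rewrite mem_iota /= => lt_m.
by case: eqP => // m0; rewrite nth_mkseq //; case: eqP.
Qed.

End Countdown.

Lemma set_nth_config K p s t v : (0 < t < K)%N ->
  set_nth 0 (config K p s) t v = config K p (upd s t v).
Proof.
move=> t_K; apply: (@eq_from_nth _ 0) => [|m]; rewrite size_set_nth !size_mkseq.
  by lia.
move=> lt_m; rewrite nth_set_nth /= !nth_mkseq; try lia.
by rewrite /upd; case: (m =P t) => // ->; case: eqP => //; lia.
Qed.

Lemma self_initE tau K z : (4 < K)%N ->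
  config K 0 (nth 0 (self_init tau K z)) = self_init tau K z.
Proof.
move=> K_gt4; apply: (@eq_from_nth _ 0) => [|m]; rewrite size_mkseq.
  by rewrite /= size_nseq; lia.
by move=> lt_m; rewrite nth_mkseq //; case: eqP => // ->.
Qed.

Theorem theorem5p8 (l : nat) (hl : (1 <= l)%N) :
  ~ exists f : mrec, computes_moment_basis l f.
Proof.
move=> [f f_basis].
have [e eP] := recursive_self_code; have [m mP] := recursive_mulc l.
(* Rebuild the code of the loop from three numbers, apply [f], multiply by [l]. *)
pose D := RComp m [:: RComp f [:: e]].
(* Registers 1, 2 and 3 are where [self_init] puts the arguments; the result goes to 4, the register
   to be counted down. *)
pose c := compile D [:: 1; 2; 3]%N 4 5.
(* Larger than 4 and than every register of [c]. *)
pose K := (sumn (com_regs c) + 5)%N.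
pose P := com_code 0 (Seq c (countdown 4)).
(* The transitions do not depend on the initial assignment, so [[::]] stands in for it here and
   their code can become part of it. *)
pose T := [seq (tprob t, guard_tree (tguard t), tmat t, tvec t)
          | t <- ltrans (program_loop K P [::])].
pose x := self_init (pickle T) K (zeros_code K).
pose L := program_loop K P x.
have K_gt4 : (4 < K)%N by rewrite /K; lia.
have K_gt0 : (0 < K)%N by lia.
have c_regs : all (fun r => 0 < r < K)%N (com_regs c).
  have regs_gt0 : all (leq 1) (com_regs c) by apply: compile_regs.
  apply/allP => r r_c; rewrite (allP regs_gt0 r r_c : 0 < r)%N /=.
  by move: r_c; rewrite /K => /splitPr[u v]; rewrite sumn_cat /=; lia.
have P_regs : all (fun i => (itst i < K) && (isrc i < K))%N P.
  by apply: com_code_regs; rewrite //= all_cat c_regs /= K_gt4.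
have x_config : config K 0 (nth 0 x) = x by apply: self_initE.
have [|out [f_out [B [B_out B_basis]]]] := f_basis L.
  by apply: program_loop_valid => //; rewrite -x_config size_mkseq.
have D_out : rec_eval D [:: pickle T; K; zeros_code K] (l * out)%N.
  apply: (ev_comp _ _ _ [:: out]); last exact: (mP [:: out]).
  constructor; last by constructor.
  apply: (ev_comp _ _ _ [:: encode_loop L]); last exact: f_out.
  by constructor; [apply: eP | constructor].
have [||||s1 [c_exec s1_4 _]] := compileP (xs := [:: 1; 2; 3]%N) (o := 4)
  (b := 5) (s := nth 0 x) _ _ _ _ D_out; try by [].
have t_K : (0 < 4 < K)%N by [].
have [M st_M] := countdown_const t_K c_regs c_exec s1_4.
(* The countdown starts at [l * out], exactly the bound that its start must stay below. *)
suff : (l * out < l * out)%N by rewrite ltnn.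
apply: (basis_code_bound (st := fun n => iter n (program_step K P) x)
  (x0 := config K (com_size c) s1) (t := 4) (M := M) hl _ _ _ _ B_out B_basis) => //.
- by move=> n; apply: program_loop_dist.
- by rewrite -x_config.
move=> j le_j; have [n st_n] := countdown_reach t_K c_regs c_exec s1_4 le_j.
by exists n; rewrite set_nth_config // -x_config.
Qed.
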